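(* Let $\varphi=(1+\sqrt5)/2$. For every finite inventory of strictly decreasing positive outer radii in a planar disk pan (with a common width $w>0$), every descending greedy execution returns the lexicographically maximum feasible subinventory when $\rho\le\varphi$. The assertion also holds when the hole radii are independent: ring $i$ has outer radius $r_i$ and an arbitrary hole radius $h_i$ with $0\le h_i<r_i$.
   Context: Model. The pan is a closed disk of radius $R$ in the plane. An inventory is a finite list of outer radii $r_1>r_2>\dots>r_n>0$, ring $i$ having a hole that is a disk of radius $h_i$. With common width $w>0$, $h_i=\max(0,r_i-w)$; with independent holes, the $h_i$ are arbitrary with $0\le h_i<r_i$. A placement of a set $S$ of rings is a forest: each ring of $S$ has as parent either the pan or another ring of $S$ (whose hole radius is at least the child's outer radius), and the children of each common parent must be packable in the parent's region (the pan, or the hole disk of radius $h_i$ of ring $i$), i.e. closed disks having the children's outer radii can be positioned inside that region with pairwise disjoint interiors. Feasibility depends only on the parent assignment. $S$ is feasible if it has a placement. The lexicographically maximum feasible set $L$ is defined by scanning $i=1,\dots,n$ and including $i$ whenever $(L\cap\{1,\dots,i-1\})\cup\{i\}$ is feasible. A descending greedy execution processes the rings in decreasing outer radius; when ring $i$ is processed, a container (the pan or the hole of an already placed ring) admits it if the container's current children together with ring $i$ are packable in it (previously chosen parents stay fixed, but sibling positions may be rearranged); the ring receives some admitting container as its permanent parent, chosen arbitrarily, and is skipped only if no container admits it. $\rho=\max_i\bigl(\sum_{j>i}r_j\bigr)/r_i$. *)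

(* Defs.v *)
From mathcomp Require Import all_boot all_order all_algebra.
From mathcomp Require Import all_classical all_reals topology normedtype.
Set Implicit Arguments.
Unset Strict Implicit.
Unset Printing Implicit Defensive.
Import Order.TTheory GRing.Theory Num.Theory.
Import numFieldNormedType.Exports.
Local Open Scope ring_scope.

(* The library norm on R * R is the sup norm, so Euclidean disks are defined
   here; the product topology, used through interior, is the usual one. *)
Definition euclidean_dist (R : realType) (x y : R * R) : R :=
  Num.sqrt ((x.1 - y.1) ^+ 2 + (x.2 - y.2) ^+ 2).

Definition closed_disk (R : realType) (c : R * R) (a : R) : set (R * R) :=
  [set x | euclidean_dist x c <= a]%classic.

(* Every region (the pan or a hole) is translated so as to be centred at 0. *)
Definition packable (R : realType) (n : nat) (r : 'I_n -> R)
    (a : R) (C : {set 'I_n}) : Prop :=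
  exists c : 'I_n -> R * R,
    (forall i, i \in C ->
       (closed_disk (c i) (r i) `<=` closed_disk (0, 0) a)%classic) /\
    (forall i j, i \in C -> j \in C -> i != j ->
       (interior (closed_disk (c i) (r i)) `&`
        interior (closed_disk (c j) (r j)) = set0)%classic).

(* A container is an [option 'I_n]: [None] is the pan, [Some j] is the hole of
   ring j. *)
Definition container_radius (R : realType) (n : nat) (pan : R) (h : 'I_n -> R)
    (c : option 'I_n) : R :=
  if c is Some j then h j else pan.

Definition available (n : nat) (S : {set 'I_n}) (c : option 'I_n) : bool :=
  if c is Some j then j \in S else true.

Definition children (n : nat) (S : {set 'I_n}) (par : 'I_n -> option 'I_n)
    (c : option 'I_n) : {set 'I_n} :=
  [set i in S | par i == c]%SET.

(* The values of [par] outside S are irrelevant. The parent relation on S is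
   automatically acyclic, hence a forest rooted at the pan: if j is the parent
   of i then r i <= h j < r j. *)
Definition placement (R : realType) (n : nat) (pan : R) (r h : 'I_n -> R)
    (S : {set 'I_n}) (par : 'I_n -> option 'I_n) : Prop :=
  (forall i, i \in S -> available S (par i)) /\
  (forall i j, i \in S -> par i = Some j -> r i <= h j) /\
  (forall c, available S c ->
     packable r (container_radius pan h c) (children S par c)).

Definition feasible (R : realType) (n : nat) (pan : R) (r h : 'I_n -> R)
    (S : {set 'I_n}) : Prop :=
  exists par : 'I_n -> option 'I_n, placement pan r h S par.

(* [enum 'I_n] lists the indices in increasing order, that is, the rings in
   decreasing order of outer radius. *)
Definition lexmax_feasible (R : realType) (n : nat) (pan : R)
    (r h : 'I_n -> R) : {set 'I_n} :=
  foldl (fun L i => if `[< feasible pan r h (i |: L)%SET >]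
                    then (i |: L)%SET else L)
        (finset.set0 : {set 'I_n}) (enum 'I_n).

Definition admits (R : realType) (n : nat) (pan : R) (r h : 'I_n -> R)
    (S : {set 'I_n}) (par : 'I_n -> option 'I_n)
    (c : option 'I_n) (i : 'I_n) : Prop :=
  available S c /\
  packable r (container_radius pan h c) (i |: children S par c)%SET.

(* [greedy_run pan r h s S par]: processing the rings of s in order may place
   exactly the rings of S, with parents given by [par] on S. *)
Inductive greedy_run (R : realType) (n : nat) (pan : R) (r h : 'I_n -> R) :
    seq 'I_n -> {set 'I_n} -> ('I_n -> option 'I_n) -> Prop :=
| greedy_start par :
    greedy_run pan r h [::] finset.set0 par
| greedy_place s S par i c :
    greedy_run pan r h s S par ->
    admits pan r h S par c i ->
    greedy_run pan r h (rcons s i) (i |: S)%SET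
      (fun j => if j == i then c else par j)
| greedy_skip s S par i :
    greedy_run pan r h s S par ->
    (forall c, ~ admits pan r h S par c i) ->
    greedy_run pan r h (rcons s i) S par.

Definition greedy_execution (R : realType) (n : nat) (pan : R)
    (r h : 'I_n -> R) (S : {set 'I_n}) (par : 'I_n -> option 'I_n) : Prop :=
  greedy_run pan r h (enum 'I_n) S par.

Definition width_hole (R : realType) (n : nat) (r : 'I_n -> R) (w : R)
    (i : 'I_n) : R :=
  Num.max 0 (r i - w).

(* All the ratios are nonnegative, so 0 is a harmless default: it is only the
   value of rho for the empty inventory. *)
Definition rho (R : realType) (n : nat) (r : 'I_n -> R) : R :=
  \big[Num.max/0]_(i < n) ((\sum_(j < n | (i < j)%N) r j) / r i).

Definition phi (R : realType) : R := (1 + Num.sqrt 5) / 2.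

(* Main.v *)
Require Import Defs.
From mathcomp Require Import all_boot all_order all_algebra.
From mathcomp Require Import all_classical all_reals topology normedtype.
From mathcomp Require Import ring lra.
Import Order.TTheory GRing.Theory Num.Theory.
Local Open Scope ring_scope.
Set Implicit Arguments.
Unset Strict Implicit.

(** The scan defining the lexicographic maximum and the greedy execution make
    the same decisions as soon as the following holds: if the rings of [S],
    all larger than ring [i], are placed by a forest [p], and some forest [q]
    places [S] together with [i], then a container of [p] admits [i]
    ([admits_of_feasible]). Let [k] be the largest ring with different parents
    in [p] and [q], and [l] the smallest ring of [S].

    If there is no such [k], the parent of [i] in [q] admits [i]. If [k = l],
    then [q] differs from [p] by the position of [k] and by [i] only: either the
    parent of [i] in [q] is unaffected by the move of [k], or [i] takes the
    place that the larger ring [k] leaves.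

    If two rings of [S], other than [l], share a parent in [p], take the first
    such pair [e, k']. Their container has radius at least [r e + r k'], and
    its other children and [i] fit in it beside them ([admits_two_children]).

    Otherwise the rings before [l] have distinct parents in [p], so that [p]
    nests the rings before [k] in a chain, and [k] is the only child of the
    innermost one. Hence the parent that [q] gives to [k] contains, in [p] and
    in [q], a ring [e] larger than [k] ([chain_sibling]). In [p] the only other
    ring in that container can be [l]. The radius of the container is at least
    [r e + r k], so that [l] fits where [q] has [k], and [i] fits in the pocket
    beside them ([packable_pocket]).

    The geometry takes place in the crescent left by a disk of radius [e]
    tangent from inside to a disk of radius [a]. The disks inscribed in the
    crescent form a family indexed by a real number [x], with radius
    [slot_radius a e x], and two of them are disjoint exactly when their
    indices differ by at least 1 ([slot_radius_dist]): consecutive integers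
    give a Pappus chain. For [a = e + k] the slot 0 has radius [k], and the
    slots 1 and -1 are the two pockets beside the tangent disks [e] and [k].
    Any rings whose radii sum to at most the radius of a slot fit in it, in a
    line. The golden ratio enters in [tail_le_two_pockets]: under the bound on
    [rho], the rings after [k] have total radius at most twice the pocket, with
    equality possible when [e = phi * k]. So only the first ring [d] after [k]
    can exceed a pocket. If it does not, the slots 1, -1 and 2 receive
    everything. If it does, but [e], [k] and [d] pack together, their packing
    can be turned into one in which [d] and [k] occupy slots [x - 1] and
    [x] ([slot_gap]), and what remains fits in the slot [x + 1], because the
    slots next to a slot have together at least twice the radius of the pocket
    ([slot_radius_pair]). *)

(** * Slots of a crescent *)

Lemma phi_sq (R : realType) : phi R ^+ 2 = phi R + 1.
Proof.
have s5 : (Num.sqrt 5 : R) ^+ 2 = 5 by rewrite sqr_sqrtr.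
rewrite /phi; move: (Num.sqrt 5) s5 => s s5; nra.
Qed.

(** Rational bounds fine enough for the polynomial inequalities below: 8/5 and
    13/8 are convergents of the golden ratio. *)
Lemma phi_bounds (R : realType) : (8 / 5 < phi R) && (phi R < 13 / 8).
Proof.
have s5 : (Num.sqrt 5 : R) ^+ 2 = 5 by rewrite sqr_sqrtr.
have s0 : 0 <= Num.sqrt 5 :> R by exact: sqrtr_ge0.
rewrite /phi; move: (Num.sqrt 5) s5 s0 => s s5 s0; apply/andP; split; nra.
Qed.

(** Pappus chains in a crescent: the radius of the disk tangent to the circle of
    radius [a] from inside and to the inner circle of radius [e] from outside,
    where [x] is the ratio of the height of its centre above the axis of the
    crescent to its diameter. The reciprocal is an affine function of [x ^+ 2],
    with slope [e^-1 - a^-1] and value [(a - e)^-1] at 0. *)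
Definition slot_radius (R : realType) (a e x : R) : R :=
  a * e * (a - e) / (x ^+ 2 * (a - e) ^+ 2 + a * e).

(** The disk tangent to two tangent disks of radii [e] and [k] and to the disk of
    radius [e + k] around them: by Descartes' circle theorem its curvature is
    [e^-1 + k^-1 - (e + k)^-1]. *)
Definition pocket (R : realType) (e k : R) : R :=
  e * k * (e + k) / (e ^+ 2 + e * k + k ^+ 2).

Section Slots.
Variable R : realType.
Implicit Types a e k d s T x y b : R.

Lemma slot_den_gt0 a e x : 0 < e -> e < a -> 0 < x ^+ 2 * (a - e) ^+ 2 + a * e.
Proof.
move=> e0 ea; have a0 : 0 < a by exact: lt_trans ea.
by apply: ltr_wpDl; [apply: mulr_ge0; exact: sqr_ge0 | exact: mulr_gt0].
Qed.

Lemma slot_radius_gt0 a e x : 0 < e -> e < a -> 0 < slot_radius a e x.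
Proof.
move=> e0 ea; have a0 : 0 < a by exact: lt_trans ea.
by rewrite divr_gt0 ?slot_den_gt0 ?mulr_gt0 ?subr_gt0.
Qed.

Lemma slot_radius0 e k : 0 < e -> 0 < k -> slot_radius (e + k) e 0 = k.
Proof. by move=> e0 k0; rewrite /slot_radius; field; lra. Qed.

Lemma slot_radius1 e k : 0 < e -> 0 < k -> slot_radius (e + k) e 1 = pocket e k.
Proof.
move=> e0 k0; rewrite /slot_radius /pocket; field; nra.
Qed.

Lemma slot_radiusN a e x : slot_radius a e (- x) = slot_radius a e x.
Proof. by rewrite /slot_radius sqrrN. Qed.

(** Where the golden ratio is decisive. For [k <= e / phi] the first bound on [T]
    is the stronger one, beyond it the second; in both regimes the inequality
    has the factor [k - (phi - 1) * e], so it is an equality at [e = phi * k]. *)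
Lemma tail_le_two_pockets e k T : 0 < k -> k <= e ->
  T <= phi R * k -> k + T <= phi R * e -> T <= 2 * pocket e k.
Proof.
move=> k0 ke T1 T2; have e0 : 0 < e by lra.
have d0 : 0 < e ^+ 2 + e * k + k ^+ 2 by nra.
rewrite /pocket mulrA ler_pdivlMr //.
have := phi_sq R; have /andP[] := phi_bounds R; move: (phi R) T1 T2 => p T1 T2 p1 p2 pp.
have [h|h] := leP k ((p - 1) * e).
  have : T * (e ^+ 2 + e * k + k ^+ 2) <= (p * k) * (e ^+ 2 + e * k + k ^+ 2).
    by rewrite ler_wpM2r // ltW.
  suff : 0 <= k * (2 * e * (e + k) - p * (e ^+ 2 + e * k + k ^+ 2)) by nra.
  apply: mulr_ge0; first lra.
  have -> : 2 * e * (e + k) - p * (e ^+ 2 + e * k + k ^+ 2) =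
    p * (((p - 1) * e - k) * (k + (2 - p) * e)).
    have : (p ^+ 2 - (p + 1)) * ((2 - p) * e ^+ 2 + 2 * e * k) = 0 by rewrite pp subrr mul0r.
    lra.
  apply: mulr_ge0; first lra.
  by apply: mulr_ge0; nra.
have : T * (e ^+ 2 + e * k + k ^+ 2) <= (p * e - k) * (e ^+ 2 + e * k + k ^+ 2).
  by rewrite ler_wpM2r //; lra.
suff : (p * e - k) * (e ^+ 2 + e * k + k ^+ 2) <= 2 * (e * k * (e + k)) by nra.
have -> : (p * e - k) * (e ^+ 2 + e * k + k ^+ 2) = 2 * (e * k * (e + k)) -
    (k - (p - 1) * e) * (k ^+ 2 + 2 * e * k + (p + 1) * e ^+ 2).
  have : (p ^+ 2 - (p + 1)) * e ^+ 3 = 0 by rewrite pp subrr mul0r.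
  lra.
suff : 0 <= (k - (p - 1) * e) * (k ^+ 2 + 2 * e * k + (p + 1) * e ^+ 2) by lra.
apply: mulr_ge0; nra.
Qed.

(** The factor [2 * phi] is what the third of three groups of rings requires in
    [packable_crescent_near]. There is some slack here, so that 5/8 can replace
    [phi - 1] as the point where the two bounds on [T] exchange their roles. *)
Lemma tail_le_slot2 e k T : 0 < k -> k <= e ->
  T <= phi R * k -> k + T <= phi R * e -> T <= 2 * phi R * slot_radius (e + k) e 2.
Proof.
move=> k0 ke T1 T2; have e0 : 0 < e by lra.
have -> : slot_radius (e + k) e 2 = e * k * (e + k) / (e ^+ 2 + e * k + 4 * k ^+ 2).
  by rewrite /slot_radius; field; nra.
have d0 : 0 < e ^+ 2 + e * k + 4 * k ^+ 2 by nra.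
rewrite mulrA ler_pdivlMr //.
have := phi_sq R; have /andP[] := phi_bounds R; move: (phi R) T1 T2 => p T1 T2 p1 p2 pp.
have [h|h] := leP (8 * k) (5 * e).
  apply: (@le_trans _ _ ((p * k) * (e ^+ 2 + e * k + 4 * k ^+ 2))).
    by rewrite ler_wpM2r // ltW.
  suff : 0 <= (p * k) * (e ^+ 2 + e * k - 4 * k ^+ 2) by nra.
  apply: mulr_ge0; nra.
apply: (@le_trans _ _ ((p * e - k) * (e ^+ 2 + e * k + 4 * k ^+ 2))).
  by rewrite ler_wpM2r //; lra.
(* In terms of q all the coefficients of the remaining cubic are positive. *)
have [q qE] : exists q, k = (5/8) * e + q by exists (k - 5/8 * e); lra.
have q0 : 0 < q by lra.
have qe : q <= 3/8 * e by lra.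
have h1 : 0 <= (13/8 - p) * (e * (2 * k ^+ 2 - e * k + e ^+ 2)).
  by apply: mulr_ge0; [lra | apply: mulr_ge0; nra].
suff : 0 <= 4 * k ^+ 3 - 9/4 * e * k ^+ 2 + 21/8 * e ^+ 2 * k - 13/8 * e ^+ 3 by lra.
rewrite qE.
have := mulr_gt0 (mulr_gt0 q0 q0) q0; have := mulr_gt0 (mulr_gt0 q0 q0) e0.
have := mulr_gt0 (mulr_gt0 q0 e0) e0; have := mulr_gt0 (mulr_gt0 e0 e0) e0.
lra.
Qed.

Lemma le_slot_radius a e x s : 0 < e -> e < a ->
  (s <= slot_radius a e x) = (s * (x ^+ 2 * (a - e) ^+ 2 + a * e) <= a * e * (a - e)).
Proof. by move=> e0 ea; rewrite /slot_radius ler_pdivlMr ?slot_den_gt0. Qed.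

Lemma pocket_mono e k k' : 0 < e -> 0 < k -> k <= k' -> pocket e k <= pocket e k'.
Proof.
move=> e0 k0 kk.
have d1 : 0 < e ^+ 2 + e * k + k ^+ 2 by nra.
have d2 : 0 < e ^+ 2 + e * k' + k' ^+ 2 by nra.
rewrite /pocket ler_pdivrMr // [leRHS]mulrAC ler_pdivlMr //.
have h1 : 0 <= e ^+ 4 * (k' - k) by apply: mulr_ge0; [exact: exprn_ge0 (ltW e0) | lra].
have h2 : 0 <= e ^+ 3 * ((k' - k) * (k' + k)).
  apply: mulr_ge0; [exact: exprn_ge0 (ltW e0) | apply: mulr_ge0; lra].
lra.
Qed.

(** Any radius up to that of the widest slot is attained: solve for [x ^+ 2]. *)
Lemma slot_radius_eq a e d : 0 < e -> 0 < d -> d <= a - e ->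
  exists2 b, 0 <= b & slot_radius a e b = d.
Proof.
move=> e0 d0 da; have b0 : 0 < a - e by lra.
have a0 : 0 < a by lra.
exists (Num.sqrt (a * e * (a - e - d) / (d * (a - e) ^+ 2))); first exact: sqrtr_ge0.
rewrite /slot_radius sqr_sqrtr; last first.
  by rewrite divr_ge0 ?mulr_ge0 ?exprn_ge0 //; lra.
have P0 : 0 < a * e * (a - e) by rewrite !mulr_gt0.
by field; rewrite !gt_eqF //; lra.
Qed.

(** At [x = 0] both sides are equal. Moving the three slots along the crescent
    makes one neighbour larger and the other smaller; the gain prevails, since
    the difference of the two sides is [x ^+ 2] times a nonnegative factor. *)
Lemma slot_radius_pair a e x : 0 < e -> e < a ->
  2 * pocket e (slot_radius a e x) <=
  slot_radius a e (x - 1) + slot_radius a e (x + 1).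
Proof.
move=> e0 ea; have a0 : 0 < a by exact: lt_trans ea.
have b0 : 0 < a - e by lra.
have N0 := slot_den_gt0 x e0 ea.
have N1 := slot_den_gt0 (x - 1) e0 ea.
have N2 := slot_den_gt0 (x + 1) e0 ea.
rewrite /slot_radius; set N := x ^+ 2 * (a - e) ^+ 2 + a * e in N0 *.
have M0 : 0 < a * (a - e) by apply: mulr_gt0.
have D0 : 0 < N ^+ 2 + N * (a * (a - e)) + (a * (a - e)) ^+ 2.
  by rewrite addr_gt0 ?exprn_gt0 ?addr_gt0 ?mulr_gt0.
have D1 := mulr_gt0 (mulr_gt0 e0 e0) D0.
have -> : pocket e (a * e * (a - e) / N) =
  a * e * (a - e) * (N + a * (a - e)) /
  (N ^+ 2 + N * (a * (a - e)) + (a * (a - e)) ^+ 2).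
rewrite /pocket; field; rewrite !gt_eqF //; lra.
rewrite -subr_ge0.
set N1' := (x - 1) ^+ 2 * (a - e) ^+ 2 + a * e in N1 *.
set N2' := (x + 1) ^+ 2 * (a - e) ^+ 2 + a * e in N2 *.
have -> : a * e * (a - e) / N1' + a * e * (a - e) / N2' - 2 * (a * e * (a - e) * (N + a * (a - e)) /
  (N ^+ 2 + N * (a * (a - e)) + (a * (a - e)) ^+ 2)) =
  a * e * (a - e) * ((N1' + N2') * (N ^+ 2 + N * (a * (a - e)) + (a * (a - e)) ^+ 2) -
    2 * (N + a * (a - e)) * (N1' * N2')) /
   (N1' * N2' * (N ^+ 2 + N * (a * (a - e)) + (a * (a - e)) ^+ 2)).
  by field; rewrite !gt_eqF.
have -> : (N1' + N2') * (N ^+ 2 + N * (a * (a - e)) + (a * (a - e)) ^+ 2) -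
    2 * (N + a * (a - e)) * (N1' * N2') =
  2 * (x ^+ 2 * (a - e) ^+ 4 * (3 * a ^+ 2 + (a - e) * e + 3 * x ^+ 2 * (a - e) ^+ 2)).
  by rewrite /N /N1' /N2'; ring.
have c0 : 0 <= 3 * a ^+ 2 + (a - e) * e + 3 * x ^+ 2 * (a - e) ^+ 2.
  by have := sqr_ge0 a; have := mulr_gt0 b0 e0; have := sqr_ge0 (x * (a - e)); lra.
apply: divr_ge0; last by rewrite ltW // !mulr_gt0.
apply: mulr_ge0; first by rewrite ltW // !mulr_gt0.
apply: mulr_ge0 => //; apply: mulr_ge0 c0; apply: mulr_ge0; first exact: sqr_ge0.
exact: exprn_ge0 (ltW b0).
Qed.

(** Positions for [k], for a smaller disk [d], possibly larger than the pocket,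
    and for a remainder [s]. The premise on [b] says that when [d] is pushed
    into its own slot [- b] there is still room for [k] at distance 1. If [d]
    fits in the slot -1, the positions -1, 0 and 1 do; otherwise [k] is moved
    from the axis away from [d] as little as possible, and
    [slot_radius_pair] bounds what [s] can use on the other side. *)
Lemma crescent_slots a e k d s : 0 < e -> 0 < d -> d <= k -> e + k <= a ->
  (forall b, 0 <= b <= 1 -> slot_radius a e b = d -> k <= slot_radius a e (1 - b)) ->
  d + s <= 2 * pocket e k -> s <= pocket e k ->
  exists x, [/\ k <= slot_radius a e x, d <= slot_radius a e (x - 1)
              & s <= slot_radius a e (x + 1)].
Proof.
move=> e0 d0 dk ka gap ds sP; have k0 : 0 < k by lra.
have ea : e < a by lra.
have aE : a = e + (a - e) by ring.
have [d1|d1] := leP d (slot_radius a e 1).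
  exists 0; split.
  - by rewrite aE slot_radius0; lra.
  - by rewrite sub0r slot_radiusN.
  - rewrite add0r aE slot_radius1 //; last lra.
    by apply: le_trans sP _; apply: pocket_mono => //; lra.
have [|b b0 bE] := @slot_radius_eq a e d e0 d0; first lra.
have b1 : b <= 1.
  have := lexx d; rewrite -{2}bE le_slot_radius // => h.
  have := d1; rewrite ltNge le_slot_radius // -ltNge => h2.
  have : 0 < d * (a - e) ^+ 2 by rewrite mulr_gt0 ?exprn_gt0 //; lra.
  move: h h2; rewrite expr1n mul1r => h h2 h3.
  rewrite leNgt; apply/negP => b1.
  have : d * (a - e) ^+ 2 <= d * (a - e) ^+ 2 * b ^+ 2.
    by rewrite ler_peMr ?(ltW h3) // expr_ge1 // ltW.
  lra.
have kn := gap b; rewrite b0 b1 in kn; have {}kn := kn isT bE.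
exists (1 - b); split => //.
  by rewrite (_ : 1 - b - 1 = - b) ?slot_radiusN ?bE //; ring.
have := slot_radius_pair (1 - b) e0 ea.
rewrite (_ : 1 - b - 1 = - b) ?slot_radiusN ?bE; last ring.
have := pocket_mono e0 k0 kn.
lra.
Qed.

(** The left-hand side is the squared distance of the centres of two slots, so
    that slots are disjoint exactly when their indices differ by at least 1. *)
Lemma slot_radius_dist a e x y : 0 < e -> e < a ->
  let u := slot_radius a e x in let v := slot_radius a e y in
  ((a + e) / (a - e)) ^+ 2 * (u - v) ^+ 2 + 4 * (x * u - y * v) ^+ 2
  = (u + v) ^+ 2 + 4 * u * v * ((x - y) ^+ 2 - 1).
Proof.
move=> e0 ea u v; have N1 := slot_den_gt0 x e0 ea; have N2 := slot_den_gt0 y e0 ea.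
rewrite /u /v /slot_radius; field; rewrite !gt_eqF //; lra.
Qed.

(** Tangency to the outer circle: when the origin is the point where the two
    circles of the crescent touch, the centre of the slot is
    [(u * (a + e) / (a - e), 2 * x * u)] and that of the outer circle [(a, 0)]. *)
Lemma slot_radius_boundary a e x : 0 < e -> e < a ->
  let u := slot_radius a e x in
  (u * (a + e) / (a - e) - a) ^+ 2 + (2 * x * u) ^+ 2 = (a - u) ^+ 2.
Proof.
move=> e0 ea u; have N1 := slot_den_gt0 x e0 ea.
rewrite /u /slot_radius; field; rewrite !gt_eqF //; lra.
Qed.

(** Tangency to the inner circle, whose centre is [(e, 0)] in the frame of
    [slot_radius_boundary]. *)
Lemma slot_radius_tangent a e x : 0 < e -> e < a ->
  let u := slot_radius a e x in
  (u * (a + e) / (a - e) - e) ^+ 2 + (2 * x * u) ^+ 2 = (e + u) ^+ 2.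
Proof.
move=> e0 ea u; have N1 := slot_den_gt0 x e0 ea.
rewrite /u /slot_radius; field; rewrite !gt_eqF //; lra.
Qed.

End Slots.

(** * Euclidean disks *)

Import numFieldNormedType.Exports.

Section Eucl.
Local Open Scope classical_set_scope.
Variable R : realType.
Implicit Types (x y z c : R * R) (a b : R).

Lemma sqr_le a b : 0 <= a -> a <= b -> a ^+ 2 <= b ^+ 2.
Proof. by move=> a0 ab; rewrite ler_pXn2r ?nnegrE // (le_trans a0). Qed.

Lemma eudist_ge0 x y : 0 <= euclidean_dist x y.
Proof. exact: sqrtr_ge0. Qed.

Lemma eudist_sq x y :
  euclidean_dist x y ^+ 2 = (x.1 - y.1) ^+ 2 + (x.2 - y.2) ^+ 2.
Proof. by rewrite sqr_sqrtr // addr_ge0 ?sqr_ge0. Qed.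

Lemma eudistC x y : euclidean_dist x y = euclidean_dist y x.
Proof. by rewrite /euclidean_dist -(sqrrN (x.1 - _)) -(sqrrN (x.2 - _)) !opprB. Qed.

Lemma eudist_le x y a : 0 <= a ->
  (euclidean_dist x y <= a) = ((x.1 - y.1) ^+ 2 + (x.2 - y.2) ^+ 2 <= a ^+ 2).
Proof. by move=> a0; rewrite -eudist_sq ler_sqr ?nnegrE ?eudist_ge0. Qed.

Lemma eudist_ge x y a : 0 <= a ->
  (a <= euclidean_dist x y) = (a ^+ 2 <= (x.1 - y.1) ^+ 2 + (x.2 - y.2) ^+ 2).
Proof. by move=> a0; rewrite -eudist_sq ler_sqr ?nnegrE ?eudist_ge0. Qed.

Lemma eudist_eq x y a : 0 <= a ->
  (x.1 - y.1) ^+ 2 + (x.2 - y.2) ^+ 2 = a ^+ 2 -> euclidean_dist x y = a.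
Proof. by move=> a0 e; rewrite /euclidean_dist e sqrtr_sqr ger0_norm. Qed.

Lemma eudist_triangle y x z :
  euclidean_dist x z <= euclidean_dist x y + euclidean_dist y z.
Proof.
have s0 := eudist_ge0 x y; have t0 := eudist_ge0 y z.
rewrite eudist_le ?addr_ge0 //.
have := eudist_sq x y; have := eudist_sq y z.
move: (euclidean_dist x y) (euclidean_dist y z) s0 t0 => s t s0 t0 t2 s2.
have [p pE] : exists p, p = x.1 - y.1 by eexists.
have [q qE] : exists q, q = x.2 - y.2 by eexists.
have [p' pE'] : exists p, p = y.1 - z.1 by eexists.
have [q' qE'] : exists q, q = y.2 - z.2 by eexists.
have -> : x.1 - z.1 = p + p' by rewrite pE pE'; ring.
have -> : x.2 - z.2 = q + q' by rewrite qE qE'; ring.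
rewrite -pE -qE -pE' -qE' in s2 t2.
suff : p * p' + q * q' <= s * t by move=> h; lra.
apply: le_trans (ler_norm _) _.
rewrite -(@ler_pXn2r _ 2) ?nnegrE ?mulr_ge0 // real_normK ?num_real // exprMn s2 t2.
rewrite -subr_ge0; have -> : (p ^+ 2 + q ^+ 2) * (p' ^+ 2 + q' ^+ 2) -
  (p * p' + q * q') ^+ 2 = (p * q' - q * p') ^+ 2 by ring.
exact: sqr_ge0.
Qed.

Lemma eudist_coord x y :
  `|x.1 - y.1| <= euclidean_dist x y /\ `|x.2 - y.2| <= euclidean_dist x y.
Proof.
by split; rewrite -(@ler_pXn2r _ 2) ?nnegrE ?eudist_ge0 // real_normK ?num_real // eudist_sq;
  rewrite ?lerDl ?lerDr sqr_ge0.
Qed.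

Lemma eudist_le_norm x y : euclidean_dist x y <= `|x.1 - y.1| + `|x.2 - y.2|.
Proof.
rewrite eudist_le ?addr_ge0 // [(`|_| + _) ^+ 2]sqrrD !real_normK ?num_real //.
have : 0 <= `|x.1 - y.1| * `|x.2 - y.2| by rewrite mulr_ge0.
lra.
Qed.

Lemma eudist_homothety c x t : 0 <= t ->
  euclidean_dist (c.1 + t * (x.1 - c.1), c.2 + t * (x.2 - c.2)) c = t * euclidean_dist x c.
Proof.
move=> t0; apply: eudist_eq; first by rewrite mulr_ge0 ?eudist_ge0.
by rewrite exprMn eudist_sq /=; ring.
Qed.

(** The extreme point of the disk lies on the ray from the origin through its
    centre. *)
Lemma disk_subset c b a : 0 < b ->
  closed_disk c b `<=` closed_disk (0, 0) a <-> euclidean_dist c (0, 0) + b <= a.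
Proof.
move=> b0; split=> [sub|le_a x xc]; last first.
  by move: xc; rewrite /closed_disk /= => xc; have := eudist_triangle c x (0, 0); lra.
have d0 := eudist_ge0 c (0, 0).
have [dp|dn] := ltP 0 (euclidean_dist c (0, 0)).
  set t := 1 + b / euclidean_dist c (0, 0).
  have t1 : 0 <= t by rewrite addr_ge0 // divr_ge0 // ltW.
  have := sub (t * c.1, t * c.2).
  rewrite /closed_disk /=.
  have -> : euclidean_dist (t * c.1, t * c.2) (0, 0) = euclidean_dist c (0, 0) + b.
    have := eudist_homothety (0, 0) c t1; rewrite /= !add0r !subr0 => ->.
    by rewrite /t mulrDl mul1r divfK // gt_eqF.
  apply; rewrite eudist_le /= ?(ltW b0) //.
  have -> : t * c.1 - c.1 = b / euclidean_dist c (0, 0) * c.1 by rewrite /t; ring.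
  have -> : t * c.2 - c.2 = b / euclidean_dist c (0, 0) * c.2 by rewrite /t; ring.
  rewrite !exprMn -mulrDr; have := eudist_sq c (0, 0); rewrite /= !subr0 => <-.
  by rewrite -mulrA -exprMn mulVf ?gt_eqF // expr1n mulr1.
have c0 : euclidean_dist c (0, 0) = 0 by apply: le_anti; rewrite dn d0.
rewrite c0 add0r.
have := sub (c.1 + b, c.2); rewrite /closed_disk /= => h.
have : euclidean_dist (c.1 + b, c.2) c <= b.
  by rewrite eudist_le ?(ltW b0) //= subrr expr0n addr0 addrAC subrr add0r.
move=> /h; have [] := eudist_coord c (0, 0); rewrite c0 /= !subr0 !normr_le0 => /eqP -> _.
rewrite add0r => /(le_trans _)-> //.
by have [] := eudist_coord (b, c.2) (0, 0); rewrite /= subr0 gtr0_norm.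
Qed.

(** A point on the bounding circle is not interior: a slight homothety from the
    centre moves it out of the disk. *)
Lemma interior_disk c b : 0 < b ->
  interior (closed_disk c b) = [set x | euclidean_dist x c < b].
Proof.
move=> b0; apply/seteqP; split=> x /=.
- rewrite /interior => /nbhs_ballP[eps /= eps0 sub].
  have d0 := eudist_ge0 x c.
  rewrite ltNge; apply/negP => bd.
  have dp : 0 < euclidean_dist x c by exact: lt_le_trans bd.
  set d := euclidean_dist x c in d0 bd dp.
  set t := eps / (2 * d).
  have t0 : 0 < t by rewrite divr_gt0 // mulr_gt0.
  have td : t * d < eps.
    have -> : t * d = eps / 2 by rewrite /t; field; rewrite gt_eqF.
    lra.
  have [x1 x2] := eudist_coord x c.
  have := sub (c.1 + (1 + t) * (x.1 - c.1), c.2 + (1 + t) * (x.2 - c.2)).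
  rewrite /closed_disk /= eudist_homothety; last by rewrite addr_ge0 // ltW.
  move=> h; have : (1 + t) * d <= b.
    apply: h; split => /=; rewrite /ball /=.
      rewrite (_ : _ - _ = - (t * (x.1 - c.1))); last by ring.
      rewrite normrN normrM gtr0_norm //; apply: le_lt_trans td.
      by rewrite ler_wpM2l // ltW.
    rewrite (_ : _ - _ = - (t * (x.2 - c.2))); last by ring.
    rewrite normrN normrM gtr0_norm //; apply: le_lt_trans td.
    by rewrite ler_wpM2l // ltW.
  have := mulr_gt0 t0 dp; lra.
- move=> xb; apply/nbhs_ballP; exists ((b - euclidean_dist x c) / 2) => /=.
    by rewrite divr_gt0 // subr_gt0.
  move=> y [/= y1 y2]; rewrite /closed_disk /=.
  apply: le_trans (eudist_triangle x _ _) _.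
  have := eudist_le_norm y x; rewrite distrC (distrC y.2).
  move: y1 y2; rewrite /ball /=; lra.
Qed.

(** If the centres are too close, the point dividing the segment between them in
    the ratio of the radii lies in both interiors. *)
Lemma disks_disjoint c c' b b' : 0 < b -> 0 < b' ->
  interior (closed_disk c b) `&` interior (closed_disk c' b') = set0 <->
  b + b' <= euclidean_dist c c'.
Proof.
move=> b0 b0'; rewrite !interior_disk //; split=> [dis|far]; last first.
  rewrite -subset0 => x /= [xc xc'].
  have := eudist_triangle x c c'; rewrite (eudistC c x); lra.
rewrite leNgt; apply/negP => near.
have s0 : 0 < b + b' by rewrite addr_gt0.
set t := b / (b + b').
have t0 : 0 < t by rewrite divr_gt0.
have t1 : t < 1 by rewrite ltr_pdivrMr // mul1r ltrDl.
suff : set0 (c.1 + t * (c'.1 - c.1), c.2 + t * (c'.2 - c.2)) by [].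
rewrite -dis; split => /=.
  rewrite eudist_homothety ?ltW // eudistC /t mulrAC ltr_pdivrMr //.
  by rewrite ltr_pM2l.
rewrite (_ : (_, _) = (c'.1 + (1 - t) * (c.1 - c'.1), c'.2 + (1 - t) * (c.2 - c'.2))); last first.
  by congr (_, _); ring.
rewrite eudist_homothety; last by rewrite subr_ge0 ltW.
have -> : 1 - t = b' / (b + b') by rewrite /t; field; rewrite gt_eqF.
by rewrite mulrAC ltr_pdivrMr // ltr_pM2l.
Qed.

End Eucl.

(** The metric form of a packing, with inequalities between distances in place of
    inclusions and interiors. *)
Definition disk_packing (R : realType) (n : nat) (r : 'I_n -> R) (a : R)
    (C : {set 'I_n}) (c : 'I_n -> R * R) : Prop :=
  (forall i, i \in C -> euclidean_dist (c i) (0, 0) + r i <= a) /\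
  (forall i j, i \in C -> j \in C -> i != j -> r i + r j <= euclidean_dist (c i) (c j)).

Lemma packableP (R : realType) (n : nat) (r : 'I_n -> R) (a : R) (C : {set 'I_n}) :
  (forall i, 0 < r i) -> packable r a C <-> exists c, disk_packing r a C c.
Proof.
move=> r0; split=> -[c [inside apart]]; exists c; split=> [i iC|i j iC jC ij].
- by apply/disk_subset => //; exact: inside.
- by apply/disks_disjoint => //; exact: apart.
- by apply/disk_subset => //; exact: inside.
- by apply/disks_disjoint => //; exact: apart.
Qed.

(** * Three disks in a disk *)

Section Gap.
Variable R : realType.
Implicit Types (a e k d b : R) (A B C : R * R).

(** In any packing of disks [e] and [k] in the disk of radius [a], the centre [D]
    of [k], seen in the frame with first axis opposite to the centre [A] of [e],
    has abscissa at least [w] and ordinate at most [2 * y * k] in absolute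
    value, where [(w, 2 * y * k)] is its position when both disks touch the
    boundary and each other. The bound on the abscissa follows from the distance
    of [A] and [D], and the one on the ordinate from the boundary. The
    coordinates appear multiplied by the norm of [A], as a dot product and a
    determinant. *)
Lemma tangent_bounds a e k A D y w : 0 < e -> e < a -> 0 < k -> 0 <= w -> 0 <= y ->
  euclidean_dist A (0, 0) + e <= a -> euclidean_dist D (0, 0) + k <= a ->
  e + k <= euclidean_dist A D -> w ^+ 2 + (2 * y * k) ^+ 2 = (a - k) ^+ 2 ->
  2 * (a - e) * w = (e + k) ^+ 2 - (a - e) ^+ 2 - (a - k) ^+ 2 ->
  [/\ 0 < euclidean_dist A (0, 0),
     euclidean_dist A (0, 0) * w <= - (A.1 * D.1 + A.2 * D.2) &
    `|A.1 * D.2 - A.2 * D.1| <= euclidean_dist A (0, 0) * (2 * y * k)].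
Proof.
move=> e0 ea k0 w0 y0 nA nD AD wy wN; have f0 : 0 < a - e by lra.
have mA := eudist_sq A (0, 0); have mD := eudist_sq D (0, 0); have mAD := eudist_sq A D.
rewrite /= !subr0 in mA mD.
have A0 := eudist_ge0 A (0, 0); have D0 := eudist_ge0 D (0, 0).
move: (euclidean_dist A (0, 0)) (euclidean_dist D (0, 0)) (euclidean_dist A D)
  A0 D0 mA mD mAD nA nD AD.
move=> m p q m0 p0 mA mD mAD nA' nD AD.
have pk : p ^+ 2 <= (a - k) ^+ 2 by rewrite ler_pXn2r ?nnegrE //; lra.
have qk : (e + k) ^+ 2 <= q ^+ 2 by rewrite ler_pXn2r ?nnegrE //; lra.
have me : m ^+ 2 <= (a - e) ^+ 2 by rewrite ler_pXn2r ?nnegrE //; lra.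
have ae0 : 0 < (a - e) ^+ 2 by rewrite exprn_gt0.
have wae : 0 <= (a - e) * w by rewrite mulr_ge0 // ltW.
have mpos : 0 < m.
  rewrite lt0r m0 andbT; apply/negP => /eqP mz.
  have A1 : A.1 = 0.
    apply/eqP; rewrite -sqrf_eq0; apply/eqP.
    by have := sqr_ge0 A.1; have := sqr_ge0 A.2; rewrite mz in mA; lra.
  have A2 : A.2 = 0.
    apply/eqP; rewrite -sqrf_eq0; apply/eqP.
    by have := sqr_ge0 A.1; have := sqr_ge0 A.2; rewrite mz in mA; lra.
  rewrite A1 A2 in mAD; lra.
have inner : m * w <= - (A.1 * D.1 + A.2 * D.2).
  have : m * w <= (a - e) * w by rewrite ler_wpM2r //; lra.
  lra.
split=> //.
have mw0 : 0 <= m * w by rewrite mulr_ge0.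
rewrite -(@ler_pXn2r _ 2) ?nnegrE ?mulr_ge0 //; try lra.
rewrite real_normK ?num_real //.
have i2 : (m * w) ^+ 2 <= (- (A.1 * D.1 + A.2 * D.2)) ^+ 2 by rewrite ler_pXn2r ?nnegrE //; lra.
have := ler_wpM2l (sqr_ge0 m) pk; rewrite -wy.
have : m ^+ 2 * p ^+ 2 = (A.1 * D.1 + A.2 * D.2) ^+ 2 + (A.1 * D.2 - A.2 * D.1) ^+ 2.
  by rewrite mA mD; ring.
lra.
Qed.

(** If three disks pack at all, they pack with [d] in its slot and [k] in the
    next one. Otherwise the extreme positions of [k] and [d] given by
    [tangent_bounds] are slots with indices less than 1 apart, hence
    overlapping; and two points of the half-plane of nonnegative abscissas that
    satisfy these bounds are farthest apart at the extreme positions. *)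
Lemma slot_gap a e k d A B C b :
  0 < d -> d <= k -> k <= e -> e + k <= a ->
  euclidean_dist A (0, 0) + e <= a ->
  euclidean_dist B (0, 0) + k <= a ->
  euclidean_dist C (0, 0) + d <= a ->
  e + k <= euclidean_dist A B ->
  e + d <= euclidean_dist A C ->
  k + d <= euclidean_dist B C ->
  0 <= b <= 1 -> slot_radius a e b = d -> k <= slot_radius a e (1 - b).
Proof.
move=> d0 dk ke ka nA nB nC AB AC BC /andP[b0 b1] bE.
have k0 : 0 < k by lra.
have e0 : 0 < e by lra.
have ea : e < a by lra.
have f0 : 0 < a - e by lra.
rewrite leNgt; apply/negP => small.
set c := (a + e) / (a - e).
have c0 : 0 < c by rewrite divr_gt0 //; lra.
set u := k * (a + e) / (a - e) - a.
set v := d * (a + e) / (a - e) - a.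
(* For v < 0 the container is so large, a > 2 e, that even e fits in place of k. *)
have v0 : 0 <= v.
  rewrite leNgt; apply/negP; rewrite subr_lt0 ltr_pdivrMr // => dlt.
  have far : e < b * (a - e).
    have := bE; rewrite /slot_radius; move/(canRL (divfK (lt0r_neq0 (slot_den_gt0 b e0 ea)))) => E1.
    have : e ^+ 2 < (b * (a - e)) ^+ 2.
      rewrite -(ltr_pM2l d0).
      have := ltr_pM2r e0 (d * (a + e)) (a * (a - e)); rewrite dlt; lra.
    by rewrite ltr_pXn2r ?nnegrE ?mulr_ge0 // ltW.
  have a2e : 2 * e < a.
    have : b * (a - e) <= a - e by rewrite ler_piMl // ltW.
    lra.
  have : e <= slot_radius a e (1 - b).
    rewrite le_slot_radius // -exprMn.
    have h0 : 0 <= (1 - b) * (a - e) by rewrite mulr_ge0 ?subr_ge0 // ltW.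
    have h1 : ((1 - b) * (a - e)) ^+ 2 <= (a - 2 * e) ^+ 2.
      by rewrite ler_pXn2r ?nnegrE //; lra.
    have h2 : 0 <= e * ((a - e) * a - ((a - 2 * e) ^+ 2 + a * e)).
      by apply: mulr_ge0; [exact: ltW | have := mulr_gt0 e0 f0; nra].
    have := ler_wpM2l (ltW e0) h1; lra.
  lra.
have u0 : 0 <= u.
  apply: le_trans v0 _; rewrite lerD2r ler_pM2r ?invr_gt0 // ler_wpM2r //; lra.
have [x x0 xE] : exists2 x, 0 <= x & slot_radius a e x = k by apply: slot_radius_eq => //; lra.
have xb : x < 1 - b.
  rewrite ltNge; apply/negP => xb.
  move: small; rewrite ltNge => /negP; apply.
  rewrite le_slot_radius //.
  have := lexx k; rewrite -{2}xE le_slot_radius //; apply: le_trans.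
  rewrite ler_wpM2l ?(ltW k0) // lerD2r ler_wpM2r ?sqr_ge0 //.
  by rewrite ler_pXn2r ?nnegrE //; lra.
have := slot_radius_boundary x e0 ea; rewrite xE /= -/u => uE.
have := slot_radius_boundary b e0 ea; rewrite bE /= -/v => vE.
have := slot_radius_dist x (- b) e0 ea; rewrite slot_radiusN /= xE bE -/c => distE.
have uvE : c ^+ 2 * (k - d) ^+ 2 = (u - v) ^+ 2 by rewrite /c /u /v; ring.
have uN : 2 * (a - e) * u = (e + k) ^+ 2 - (a - e) ^+ 2 - (a - k) ^+ 2.
  by rewrite /u; field; lra.
have vN : 2 * (a - e) * v = (e + d) ^+ 2 - (a - e) ^+ 2 - (a - d) ^+ 2.
  by rewrite /v; field; lra.
have [m0 iB oB] := tangent_bounds e0 ea k0 u0 x0 nA nB AB uE uN.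
have [_ iC oC] := tangent_bounds e0 ea d0 v0 b0 nA nC AC vE vN.
have mA := eudist_sq A (0, 0); have mB := eudist_sq B (0, 0).
have mC := eudist_sq C (0, 0); have mBC := eudist_sq B C.
have B0 := eudist_ge0 B (0, 0); have C0 := eudist_ge0 C (0, 0).
rewrite /= !subr0 in mA mB mC.
have BC2 : (k + d) ^+ 2 <= euclidean_dist B C ^+ 2.
  by apply: sqr_le BC; rewrite addr_ge0 // ltW.
have Bk : euclidean_dist B (0, 0) ^+ 2 <= (a - k) ^+ 2.
  by apply: sqr_le; rewrite ?lerBrDr.
have Cd : euclidean_dist C (0, 0) ^+ 2 <= (a - d) ^+ 2.
  by apply: sqr_le; rewrite ?lerBrDr.
move: (euclidean_dist A (0, 0)) m0 iB oB iC oC mA => m m0 iB oB iC oC mA.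
have m20 : 0 < m ^+ 2 by rewrite exprn_gt0.
have inn : m * u * (m * v) <= (A.1 * B.1 + A.2 * B.2) * (A.1 * C.1 + A.2 * C.2).
  rewrite -[leRHS]mulrNN; apply: ler_pM => //; rewrite mulr_ge0 // ltW //.
have out : - ((A.1 * B.2 - A.2 * B.1) * (A.1 * C.2 - A.2 * C.1)) <=
    m * (2 * x * k) * (m * (2 * b * d)).
  apply: le_trans (ler_norm _) _; rewrite normrN normrM; exact: ler_pM.
have BCdot : u * v - 4 * x * b * k * d <= B.1 * C.1 + B.2 * C.2.
  rewrite -(ler_pM2l m20).
  have -> : m ^+ 2 * (B.1 * C.1 + B.2 * C.2) =
      (A.1 * B.1 + A.2 * B.2) * (A.1 * C.1 + A.2 * C.2) +
      (A.1 * B.2 - A.2 * B.1) * (A.1 * C.2 - A.2 * C.1).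
    by rewrite mA; ring.
  lra.
have fin : 0 <= 4 * k * d * ((x - - b) ^+ 2 - 1).
  rewrite uvE in distE.
  clear - distE uE vE BCdot BC2 mBC mB mC Bk Cd.
  lra.
have kd : 0 < 4 * k * d by rewrite !mulr_gt0.
have : (x + b) ^+ 2 < 1 by rewrite expr_lt1 ?addr_ge0 // -ltrBrDr.
by rewrite ltNge -subr_ge0 -(pmulr_rge0 _ kd) -[X in x + X]opprK fin.
Qed.
End Gap.

(** * Packings by slots *)

Section Packing.
Variables (R : realType) (n : nat) (r : 'I_n -> R).
Hypothesis r_gt0 : forall i, 0 < r i.
Implicit Types (a s : R) (C D : {set 'I_n}) (e i j k d : 'I_n).

Lemma packableS a C D : C \subset D -> packable r a D -> packable r a C.
Proof.
move=> /fintype.subsetP sCD [c [inside apart]]; exists c.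
split=> [i /sCD|i j /sCD iD /sCD jD]; first exact: inside.
exact: apart.
Qed.

Lemma packable0 a : packable r a finset.set0.
Proof. by exists (fun=> (0, 0)); split=> [i|i j]; rewrite finset.in_set0. Qed.

Lemma packable_le a b C : a <= b -> packable r a C -> packable r b C.
Proof.
move=> ab; rewrite !packableP // => -[c [inside apart]]; exists c; split=> // i iC.
exact: le_trans (inside i iC) ab.
Qed.

Lemma packable_radius a C i : packable r a C -> i \in C -> r i <= a.
Proof.
rewrite packableP // => -[c [inside _]] /inside; apply: le_trans.
by rewrite lerDr eudist_ge0.
Qed.

Lemma packable_radius2 a C i j : packable r a C -> i \in C -> j \in C -> i != j ->
  r i + r j <= a.
Proof.
rewrite packableP // => -[c [inside apart]] iC jC ij.
have := apart i j iC jC ij; have := inside i iC; have := inside j jC.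
have := eudist_triangle (0, 0) (c i) (c j); rewrite (eudistC (0, 0)); lra.
Qed.

(** Abscissa of the centre of ring [i] when the rings of [D] stand in a row, in
    increasing order of index, starting from the left end of a disk of radius
    [s]. *)
Definition line_offset s D i : R :=
  - s + 2 * (\sum_(j in D | (j < i)%N) r j) + r i.

Lemma line_offset_inside s D i : \sum_(j in D) r j <= s -> i \in D ->
  `|line_offset s D i| + r i <= s.
Proof.
move=> sum_le iD; rewrite /line_offset.
have ri := r_gt0 i.
have p0 : 0 <= \sum_(j in D | (j < i)%N) r j by apply: sumr_ge0 => j _; exact: ltW.
have p1 : \sum_(j in D | (j < i)%N) r j + r i <= s.
  apply: le_trans sum_le; rewrite [leRHS](bigID (fun j : 'I_n => (j < i)%N)) /= lerD2l.
  rewrite (bigD1 i) /= ?iD ?ltnn // lerDl; apply: sumr_ge0 => j _; exact: ltW.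
rewrite -lerBrDr ler_norml; apply/andP; split; lra.
Qed.

Lemma line_offset_lt s D i j : i \in D -> (i < j)%N ->
  r i + r j <= line_offset s D j - line_offset s D i.
Proof.
move=> iD ij; rewrite /line_offset.
have : \sum_(l in D | (l < i)%N) r l + r i <= \sum_(l in D | (l < j)%N) r l.
  rewrite [leRHS](bigID (fun l : 'I_n => (l < i)%N)) /=; apply: lerD.
    rewrite le_eqVlt; apply/orP; left; apply/eqP; apply: eq_bigl => l.
    rewrite -andbA; congr (_ && _); case: ltnP => [li|]; rewrite ?andbF //.
    by rewrite (ltn_trans li ij).
  rewrite (bigD1 i) /=; last by rewrite iD ij ltnn.
  by rewrite lerDl; apply: sumr_ge0 => l _; exact: ltW.
lra.
Qed.

Lemma line_offset_apart s D i j : i \in D -> j \in D -> i != j ->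
  r i + r j <= `|line_offset s D i - line_offset s D j|.
Proof.
move=> iD jD; rewrite neq_ltn => /orP[ij|ji].
  by rewrite distrC; apply: le_trans (line_offset_lt s iD ij) (ler_norm _).
by rewrite addrC; apply: le_trans (line_offset_lt s jD ji) (ler_norm _).
Qed.

(** The function [g] assigns the rings to groups and [x] assigns slots to groups;
    the rings of a group stand in a row inside their slot. *)
Lemma slot_packable (T : eqType) a e C (g : 'I_n -> T) (x : T -> R) : r e < a ->
  (forall i j, i \in C -> j \in C -> g i != g j -> 1 <= `|x (g i) - x (g j)|) ->
  (forall i, i \in C -> \sum_(j in C | g j == g i) r j <= slot_radius a (r e) (x (g i))) ->
  packable r a (e |: C)%SET.
Proof.
move=> ea spaced fits; pose pos i := x (g i); rewrite packableP //.
have e0 := r_gt0 e.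
have f0 : 0 < a - r e by lra.
pose S i := slot_radius a (r e) (pos i).
pose D i : {set 'I_n} := [set j in C | g j == g i]%SET.
have inD i j : i \in C -> (i \in D j) = (g i == g j) by rewrite inE => ->.
have sumD i : i \in C -> \sum_(j in D i) r j <= S i.
  move=> iC; apply: le_trans (fits i iC); rewrite le_eqVlt; apply/orP; left; apply/eqP.
  by apply: eq_bigl => j; rewrite inE.
pose z i : R * R := (S i * (a + r e) / (a - r e) - a, 2 * pos i * S i).
pose o i := line_offset (S i) (D i) i.
pose c i : R * R := if i == e then (- (a - r e), 0) else ((z i).1 + o i, (z i).2).
have S0 i : 0 < S i by exact: slot_radius_gt0.
have o_in i : i \in C -> `|o i| + r i <= S i.
  by move=> iC; apply: line_offset_inside (sumD i iC) _; rewrite inD.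
have Sle i : S i <= a - r e.
  rewrite -(slot_radius0 e0 f0) (_ : r e + (a - r e) = a); last by ring.
  rewrite le_slot_radius // expr0n mul0r add0r.
  have := lexx (S i); rewrite {2}/S le_slot_radius //; apply: le_trans.
  by rewrite ler_wpM2l ?(ltW (S0 i)) // lerDr mulr_ge0 ?sqr_ge0.
have cz i : i != e -> euclidean_dist (c i) (z i) = `|o i|.
  move=> ie; apply: eudist_eq => //; rewrite /c (negPf ie) /= real_normK ?num_real //; ring.
have z0 i : euclidean_dist (z i) (0, 0) = a - S i.
  apply: eudist_eq; first by have := Sle i; lra.
  have := slot_radius_boundary (pos i) e0 ea; rewrite /= -/(S i) => <-.
  by rewrite !subr0.
have ze i : euclidean_dist (z i) (- (a - r e), 0) = r e + S i.
  apply: eudist_eq; first by have := S0 i; lra.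
  have := slot_radius_tangent (pos i) e0 ea; rewrite /= -/(S i) => <-.
  by ring.
have zz i j : 1 <= `|pos i - pos j| -> S i + S j <= euclidean_dist (z i) (z j).
  move=> far; rewrite eudist_ge; last by rewrite addr_ge0 // ltW.
  have := slot_radius_dist (pos i) (pos j) e0 ea; rewrite /= -/(S i) -/(S j).
  rewrite (_ : (z i).1 - (z j).1 = (a + r e) / (a - r e) * (S i - S j)); last first.
    by rewrite /z /=; ring.
  rewrite (_ : (z i).2 - (z j).2 = 2 * (pos i * S i - pos j * S j)); last first.
    by rewrite /z /=; ring.
  rewrite !exprMn (_ : 2 ^+ 2 = 4 :> R); last by ring.
  move=> ->; rewrite lerDl; apply: mulr_ge0.
    by apply: mulr_ge0; [apply: mulr_ge0 => //|]; exact: ltW.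
  rewrite subr_ge0.
  by rewrite -(real_normK (num_real (pos i - pos j))) expr_ge1.
have cE : c e = (- (a - r e), 0) by rewrite /c eqxx.
have apart_e i : i \in C -> i != e -> r e + r i <= euclidean_dist (c i) (c e).
  move=> iC ie; have := o_in i iC; have := cz i ie; have := ze i.
  have := eudist_triangle (c i) (z i) (c e); rewrite (eudistC (z i) (c i)) cE; lra.
exists c; split=> [i|i j].
  rewrite in_setU1; have [-> _|ie /= iC] := eqVneq i e.
    rewrite (@eudist_eq _ _ _ (a - r e)); [lra|lra|].
    by rewrite /c eqxx /=; ring.
  have := eudist_triangle (z i) (c i) (0, 0); rewrite cz // z0.
  have := o_in i iC; lra.
rewrite !in_setU1; have [-> _|ie /= iC] := eqVneq i e.
  have [->|je /= jC _] := eqVneq j e; first by [].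
  by rewrite eudistC; exact: apart_e.
have [-> _ _|je /= jC ij] := eqVneq j e; first by rewrite addrC; exact: apart_e.
have [same|/(spaced i j iC jC) far] := eqVneq (g i) (g j); last first.
  have := eudist_triangle (c i) (z i) (z j); have := eudist_triangle (c j) (c i) (z j).
  rewrite (eudistC (z i) (c i)) !cz //.
  by have := zz i j far; have := o_in i iC; have := o_in j jC; lra.
have SE : S i = S j by rewrite /S /pos same.
have DE : D i = D j by apply/setP => l; rewrite !inE same.
apply: (@le_trans _ _ `|o i - o j|).
  rewrite /o SE DE; apply: line_offset_apart => //; rewrite inD // same eqxx //.
apply: le_trans (eudist_coord (c i) (c j)).1.
rewrite /c (negPf ie) (negPf je) /= /z /= SE.
by rewrite le_eqVlt; apply/orP; left; apply/eqP; congr `|_|; ring.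
Qed.
End Packing.

(** * Tails of the inventory in a crescent *)

Lemma spacedP (R : realType) (u v : R) : 1 <= u - v \/ 1 <= v - u -> 1 <= `|u - v|.
Proof. by move=> /orP; rewrite ler_normr opprB. Qed.

Lemma spaced_positions (R : realType) (y z : R) s t :
  (y = -1 /\ z = 2) \/ (y = 2 /\ z = -1) -> (s < 4)%N -> (t < 4)%N -> s != t ->
  1 <= `|nth 0 [:: 0; 1; y; z] s - nth 0 [:: 0; 1; y; z] t|.
Proof.
move=> yz s4 t4 st; apply: spacedP.
by move: s t s4 t4 st => [|[|[|[|//]]]] [|[|[|[|//]]]] //= _ _ _;
  case: yz => -[yE zE]; rewrite ?yE ?zE; ((left; lra) || (right; lra)).
Qed.

Section Tails.
Variables (R : realType) (n : nat) (r : 'I_n -> R).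
Hypothesis r_gt0 : forall i, 0 < r i.
Hypothesis r_decr : forall i j : 'I_n, (i < j)%N -> r j < r i.
Hypothesis tail_le : forall i : 'I_n, \sum_(j : 'I_n | (i < j)%N) r j <= phi R * r i.
Implicit Types (a s : R) (C D : {set 'I_n}) (e i j k d : 'I_n).

Lemma tail_sum D i : (forall j, j \in D -> (i < j)%N) -> \sum_(j in D) r j <= phi R * r i.
Proof.
move=> lt; apply: le_trans (tail_le i).
rewrite [leRHS](bigID (mem D)) /= (eq_bigl (fun j : 'I_n => (i < j)%N && (j \in D))).
  by rewrite lerDl; apply: sumr_ge0 => j _; exact: ltW.
by move=> j; case jD: (j \in D); rewrite ?andbF // lt.
Qed.

Lemma tail_capacity e k D : (e < k)%N -> (forall j, j \in D -> (k < j)%N) ->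
  \sum_(j in D) r j <= 2 * pocket (r e) (r k) /\
  \sum_(j in D) r j <= 2 * phi R * slot_radius (r e + r k) (r e) 2.
Proof.
move=> ek kD; have ke := ltW (r_decr ek).
have T1 := tail_sum kD.
have T2 : r k + \sum_(j in D) r j <= phi R * r e.
  rewrite -big_setU1 /=; last by apply/negP => /kD; rewrite ltnn.
  by apply: tail_sum => j; rewrite in_setU1 => /orP[/eqP->//|/kD]; exact: ltn_trans.
by split; [exact: tail_le_two_pockets | exact: tail_le_slot2].
Qed.

(** The premise of [crescent_slots], read off a packing of the three rings. *)
Lemma gap_of_packing a e k d : (e < k)%N -> (k < d)%N -> packable r a (e |: [set k; d])%SET ->
  forall b, 0 <= b <= 1 -> slot_radius a (r e) b = r d -> r k <= slot_radius a (r e) (1 - b).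
Proof.
move=> ek kd pack; have ed := ltn_trans ek kd.
have := packable_radius2 r_gt0 pack (i := e) (j := k).
move: pack; rewrite packableP // => -[c [inside apart]].
rewrite !inE !eqxx ?orbT /= => /(_ isT isT) eka b b01.
apply: (slot_gap (A := c e) (B := c k) (C := c d)) => //.
all: try exact: ltW (r_decr _).
- by apply: eka; rewrite neq_ltn ek.
- by apply: inside; rewrite !inE eqxx.
- by apply: inside; rewrite !inE eqxx !orbT.
- by apply: inside; rewrite !inE eqxx !orbT.
- by apply: apart; rewrite ?inE ?eqxx ?orbT // neq_ltn ek.
- by apply: apart; rewrite ?inE ?eqxx ?orbT // neq_ltn ed.
- by apply: apart; rewrite ?inE ?eqxx ?orbT // neq_ltn kd.
Qed.

Lemma sum_singleton_class (T : eqType) (g : 'I_n -> T) C i : i \in C ->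
  (forall j, j \in C -> g j = g i -> j = i) -> \sum_(j in C | g j == g i) r j = r i.
Proof.
move=> iC single; rewrite (eq_bigl (pred1 i)) ?big_pred1_eq // => j.
apply/andP/eqP => [[jC /eqP]|->]; [exact: single | by rewrite iC eqxx].
Qed.

(** The slots -1 and 2 come in either order because the wider one, -1, must serve
    the larger of the last two groups. *)
Lemma packable_four_slots a e k d d2 D y z : r e < a ->
  k \notin D -> d \in D -> d2 \in (D :\ d)%SET ->
  (y = -1 /\ z = 2) \/ (y = 2 /\ z = -1) ->
  r k <= slot_radius a (r e) 0 -> r d <= slot_radius a (r e) 1 ->
  r d2 <= slot_radius a (r e) y -> \sum_(j in D :\ d :\ d2) r j <= slot_radius a (r e) z ->
  packable r a (e |: (k |: D))%SET.
Proof.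
move=> ea kD dD; rewrite in_setD1 => /andP[d2d d2D] yz rk rd rd2 Qz.
have dk : d != k by apply: contraNneq kD => <-.
have d2k : d2 != k by apply: contraNneq kD => <-.
pose g i := if i == k then 0%N else if i == d then 1%N else if i == d2 then 2%N else 3%N.
have gk : g k = 0%N by rewrite /g eqxx.
have gd : g d = 1%N by rewrite /g (negPf dk) eqxx.
have gd2 : g d2 = 2%N by rewrite /g (negPf d2k) (negPf d2d) eqxx.
have kC : k \in (k |: D)%SET by rewrite setU11.
have dC : d \in (k |: D)%SET by rewrite setU1r.
have d2C : d2 \in (k |: D)%SET by rewrite setU1r.
apply: (slot_packable r_gt0 (g := g) (x := nth 0 [:: 0; 1; y; z])) => // [i j _ _|i iC].
  by apply: spaced_positions => //; rewrite /g; do 3 case: ifP => // _.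
have [->|ik] := eqVneq i k.
  rewrite sum_singleton_class ?gk // => j _; rewrite /g.
  by case: eqVneq => // _; do 2 case: ifP => // _.
have [->|id] := eqVneq i d.
  rewrite sum_singleton_class ?gd // => j _; rewrite /g.
  by case: ifP => // _; case: eqVneq => // _; case: ifP.
have [->|id2] := eqVneq i d2.
  rewrite sum_singleton_class ?gd2 // => j _; rewrite /g.
  by do 2 case: ifP => // _; case: eqVneq.
have -> : g i = 3%N by rewrite /g (negPf ik) (negPf id) (negPf id2).
rewrite (eq_bigl (mem (D :\ d :\ d2)%SET)) // => j.
rewrite /g /= !in_setD1 in_setU1; have [->|_] := eqVneq j k.
  by rewrite (negPf kD) !andbF.
by case: (j == d); case: (j == d2); rewrite ?andbF ?andbT.
Qed.

(** Here [d] may be too large for a pocket, and only its packing with [e] and [k]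
    tells how [k] and [d] can be arranged. *)
Lemma packable_crescent_far a e k d D :
  (e < k)%N -> (forall j, j \in D -> (k < j)%N) -> d \in D ->
  packable r a (e |: [set k; d])%SET ->
  \sum_(j in D :\ d) r j <= pocket (r e) (r k) ->
  packable r a (e |: (k |: D))%SET.
Proof.
move=> ek kD dD pack sP; have kd := kD d dD.
have eka : r e + r k <= a.
  by apply: packable_radius2 pack _ _ _; rewrite // ?inE ?eqxx ?orbT // neq_ltn ek.
have ea : r e < a by have := r_gt0 k; lra.
have [T2 _] := tail_capacity ek kD.
rewrite (big_setD1 d dD) /= in T2.
have [x [xk xd xs]] := crescent_slots (r_gt0 e) (r_gt0 d) (ltW (r_decr kd)) eka
  (gap_of_packing ek kd pack) T2 sP.
have kND : k \notin D by apply/negP => /kD; rewrite ltnn.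
have dk : d != k by rewrite neq_ltn kd orbT.
pose g i := if i == k then 0%N else if i == d then 1%N else 2%N.
have gk : g k = 0%N by rewrite /g eqxx.
have gd : g d = 1%N by rewrite /g (negPf dk) eqxx.
have kC : k \in (k |: D)%SET by rewrite setU11.
have dC : d \in (k |: D)%SET by rewrite setU1r.
apply: (slot_packable r_gt0 (g := g) (x := nth 0 [:: x; x - 1; x + 1])) => // [i j _ _|i iC].
  rewrite /g => ne; apply: spacedP; move: ne => /=.
  by case: (i == k); case: (j == k) => //=; case: (i == d); case: (j == d) => //= _;
    ((left; lra) || (right; lra)).
have [->|ik] := eqVneq i k.
  rewrite sum_singleton_class ?gk // => j _; rewrite /g.
  by case: eqVneq => // _; case: ifP.
have [->|id] := eqVneq i d.
  rewrite sum_singleton_class ?gd // => j _; rewrite /g.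
  by case: ifP => // _; case: eqVneq.
have -> : g i = 2%N by rewrite /g (negPf ik) (negPf id).
rewrite (eq_bigl (mem (D :\ d)%SET)) // => j.
rewrite /g /= in_setD1 in_setU1; have [->|_] := eqVneq j k.
  by rewrite (negPf kND) andbF.
by case: (j == d); rewrite ?andbF ?andbT.
Qed.

(** The smallest container that holds [e] and [k] has room for [i] in a pocket,
    and [x] is not larger than [k]: the rings go to the slots 0 and 1. *)
Lemma packable_pocket a e k (x : 'I_n) i : (e < k)%N -> (k <= x)%N -> r e + r k <= a ->
  r i <= pocket (r e) (r k) -> i != x -> packable r a (e |: [set x; i])%SET.
Proof.
move=> ek kx eka iP ix; apply: packable_le eka _ => //.
have xk : r x <= r k.
  by move: kx; rewrite leq_eqVlt => /orP[/eqP/val_inj->//|/r_decr/ltW].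
apply: (slot_packable r_gt0 (g := fun j => j == x) (x := fun b : bool => if b then 0 else 1)).
- by rewrite ltrDl.
- move=> j l _ _ ne; apply: spacedP; move: ne.
  by case: (j == x); case: (l == x) => //= _; ((left; lra) || (right; lra)).
move=> j; rewrite !inE; have [-> _|jx _] := eqVneq j x.
  rewrite (eq_bigl (pred1 x)) ?big_pred1_eq ?slot_radius0 // => l.
  by rewrite /= !inE; case: (l == x); rewrite ?andbF.
rewrite (eq_bigl (pred1 i)) ?big_pred1_eq ?slot_radius1 // => l.
rewrite /= !inE; case: (eqVneq l x) => [->|_] /=; last by rewrite andbT.
by rewrite [x == i]eq_sym (negPf ix).
Qed.

(** Since two pockets suffice for the total, [d] fits in one when the rings after
    it do not. Let [d2] be the next ring and [Q] the total of the others. Both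
    are at most a pocket, and the smaller of the two is at most half of
    [r d2 + Q], which fits in the slot 2: the bound on [rho] at [d] gives
    [phi * (r d2 + Q) <= r d + r d2 + Q], and [tail_le_slot2] applies. *)
Lemma packable_crescent_near a e k d D :
  (e < k)%N -> (forall j, j \in D -> (k < j)%N) -> d \in D ->
  (forall j, j \in D -> (d <= j)%N) -> r e + r k <= a ->
  pocket (r e) (r k) < \sum_(j in D :\ d) r j ->
  packable r a (e |: (k |: D))%SET.
Proof.
move=> ek kD dD d_min eka sP; apply: packable_le eka _ => //.
have kd := kD d dD.
have P0 : 0 < pocket (r e) (r k).
  by rewrite -slot_radius1 // slot_radius_gt0 // ltrDl.
have [i0 i0D] : exists i, i \in (D :\ d)%SET.
  apply/set0Pn; apply/eqP => D0; move: sP; rewrite D0 big_set0; lra.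
pose d2 := [arg min_(i < i0 in (D :\ d)%SET) (i : nat)]%N.
have [d2D d2_min] : d2 \in (D :\ d)%SET /\ forall j, j \in (D :\ d)%SET -> (d2 <= j)%N.
  by rewrite /d2; case: fintype.arg_minnP.
have d_lt j : j \in (D :\ d)%SET -> (d < j)%N.
  by rewrite in_setD1 ltn_neqAle => /andP[jd /d_min->]; rewrite eq_sym jd.
have d2_lt j : j \in (D :\ d :\ d2)%SET -> (d2 < j)%N.
  by rewrite in_setD1 ltn_neqAle => /andP[jd /d2_min->]; rewrite eq_sym jd.
have [T2 T2phi] := tail_capacity ek kD.
have S1 := tail_sum d_lt; have S2 := tail_sum d2_lt.
rewrite (big_setD1 d dD) /= (big_setD1 d2 d2D) /= in T2 T2phi.
rewrite (big_setD1 d2 d2D) /= in S1 sP.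
have dd2 := r_decr (d_lt d2 d2D); have d20 := r_gt0 d2.
set Q := \sum_(j in D :\ d :\ d2) r j in S1 S2 T2 T2phi sP.
have Q0 : 0 <= Q by apply: sumr_ge0 => j _; exact: ltW.
have pp := phi_sq R; have /andP[p1 p2] := phi_bounds R.
have dP : r d <= pocket (r e) (r k) by lra.
have QP : Q <= pocket (r e) (r k).
  have : phi R * r d2 <= 2 * r d2 by rewrite ler_wpM2r //; lra.
  lra.
have half : r d2 + Q <= 2 * slot_radius (r e + r k) (r e) 2.
  have : phi R * (r d2 + Q) <= r d + (r d2 + Q).
    have : (r d2 + Q) * phi R <= (phi R * r d) * phi R by rewrite ler_wpM2r //; lra.
    have : (phi R ^+ 2 - (phi R + 1)) * r d = 0 by rewrite pp subrr mul0r.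
    have : 0 <= (phi R - 1) * (phi R * r d - (r d2 + Q)) by apply: mulr_ge0; lra.
    lra.
  move=> h; rewrite -(@ler_pM2l _ (phi R)); last by lra.
  lra.
(* The larger of the two groups goes to the free pocket, the other to slot 2. *)
have [y [z [yz d2y Qz]]] : exists y z, [/\ (y = -1 /\ z = 2) \/ (y = 2 /\ z = -1),
    r d2 <= slot_radius (r e + r k) (r e) y & Q <= slot_radius (r e + r k) (r e) z].
  have [le|lt] := leP Q (r d2).
    exists (-1), 2; split; [by left| |lra].
    by rewrite slot_radiusN slot_radius1 //; lra.
  exists 2, (-1); split; [by right|lra|].
  by rewrite slot_radiusN slot_radius1.
apply: (packable_four_slots _ _ dD d2D yz _ _ d2y Qz); last by rewrite slot_radius1.
- by rewrite ltrDl.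
- by apply/negP => /kD; rewrite ltnn.
- by rewrite slot_radius0.
Qed.

(** Once [e], [k] and the first ring after [k] pack together, all later rings
    follow at no cost in radius. *)
Lemma packable_crescent a e k d D :
  (e < k)%N -> (forall j, j \in D -> (k < j)%N) -> d \in D ->
  (forall j, j \in D -> (d <= j)%N) -> packable r a (e |: [set k; d])%SET ->
  packable r a (e |: (k |: D))%SET.
Proof.
move=> ek kD dD d_min pack.
have [sP|sP] := leP (\sum_(j in D :\ d) r j) (pocket (r e) (r k)).
  exact: packable_crescent_far dD pack sP.
apply: packable_crescent_near dD d_min _ sP => //.
by apply: packable_radius2 pack _ _ _; rewrite // ?inE ?eqxx ?orbT // neq_ltn ek.
Qed.

End Tails.

(** * Greedy placements *)

Section Greedy.
Variables (R : realType) (n : nat) (pan : R) (r h : 'I_n -> R).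
Hypothesis r_gt0 : forall i, 0 < r i.
Hypothesis r_decr : forall i j : 'I_n, (i < j)%N -> r j < r i.
Hypothesis tail_le : forall i : 'I_n, \sum_(j : 'I_n | (i < j)%N) r j <= phi R * r i.
Hypothesis h_lt : forall i, h i < r i.
Implicit Types (S C D : {set 'I_n}) (i j k d e l : 'I_n) (p q : 'I_n -> option 'I_n).

(** The smaller ring is put at the centre of the larger one. *)
Lemma packable_replace a C i k : k \notin C -> r i <= r k ->
  packable r a (k |: C)%SET -> packable r a (i |: C)%SET.
Proof.
move=> kC ik; rewrite !packableP // => -[c [inside apart]].
have kk : k \in (k |: C)%SET by rewrite setU11.
exists (fun j => if j == i then c k else c j); split=> [j|j l].
  rewrite in_setU1; have [-> _|ji /= jC] := eqVneq j i; last by apply: inside; rewrite setU1r.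
  by apply: le_trans (inside k kk); rewrite lerD2l.
have ap j' : j' \in C -> r i + r j' <= euclidean_dist (c k) (c j').
  move=> jC; apply: le_trans (apart k j' kk _ _); rewrite ?lerD2r ?setU1r //.
  by apply: contraNneq kC => ->.
rewrite !in_setU1; have [->|ji] /= := eqVneq j i; have [->|li] //= := eqVneq l i.
- by move=> _ lC _; exact: ap.
- by move=> jC _ _; rewrite addrC eudistC; exact: ap.
- by move=> jC lC; apply: apart; rewrite setU1r.
Qed.

Lemma parent_lt S p i j : placement pan r h S p -> i \in S -> p i = Some j -> (j < i)%N.
Proof.
move=> [_ [fit _]] iS pij; rewrite ltnNge; apply/negP => ij.
have le : r j <= r i by move: ij; rewrite leq_eqVlt => /orP[/eqP/val_inj->//|/r_decr/ltW].
have := fit i j iS pij; have := h_lt j; lra.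
Qed.

Lemma available_parent S p i k : (forall j, j \in S -> (j < i)%N) -> (k <= i)%N ->
  placement pan r h (i |: S)%SET p -> k \in (i |: S)%SET -> available S (p k).
Proof.
move=> lt ki P kS; have := parent_lt P kS; have := P.1 k kS.
case: (p k) => //= j; rewrite in_setU1 => /orP[/eqP->|//] /(_ i erefl).
by rewrite ltnNge ki.
Qed.

Lemma admits_of_agree S p q i c : placement pan r h (i |: S)%SET q ->
  q i = c -> available S c -> (forall j, j \in S -> p j = c -> q j = c) ->
  admits pan r h S p c i.
Proof.
move=> [_ [_ pack]] qi av agree; split=> //.
have av' : available (i |: S)%SET c by case: c av {qi agree} => //= j jS; rewrite setU1r.
apply: packableS (pack c av'); apply/fintype.subsetP => j.
rewrite /children !inE => /orP[/eqP->|/andP[jS /eqP pj]]; first by rewrite eqxx qi eqxx.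
by rewrite jS orbT agree ?eqxx.
Qed.

(** Two rings after [k] share the capacity of two pockets, so the smaller one
    takes at most one of them. *)
Lemma second_tail_ring_le_pocket e k l i : (e < k)%N -> (k < l)%N -> (l < i)%N ->
  r i <= pocket (r e) (r k).
Proof.
move=> ek kl li.
have [|T _] := tail_capacity r_gt0 r_decr tail_le (D := [set l; i]%SET) ek.
  by move=> j; rewrite !inE => /orP[]/eqP-> //; exact: ltn_trans li.
rewrite (big_setU1 l) ?big_set1 /= in T; last by rewrite !inE neq_ltn li.
have := r_decr li; lra.
Qed.

(** Let [D] be the set of children after [e] and [k]. If [D] is empty, [i] goes to
    the pocket: it is not the first ring after [k], because of [l]. Otherwise the
    first ring of [D] is already packed with [e] and [k], and
    [packable_crescent] applies to [D] and [i]. *)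
Lemma admits_two_children S p i l e k : (forall j, j \in S -> (j < i)%N) ->
  placement pan r h S p -> e \in S -> k \in S -> l \in S ->
  (e < k)%N -> (k < l)%N -> p e = p k ->
  (forall j, j \in S -> p j = p k -> j != e -> j != k -> (k < j)%N) ->
  admits pan r h S p (p k) i.
Proof.
move=> lti P eS kS lS ek kl pek first; have [av [_ pack]] := P.
have avk := av k kS; split=> //.
have {}pack := pack _ avk; set a := container_radius _ _ _ in pack *.
set C := children S p (p k) in pack *.
have eC : e \in C by rewrite inE eS pek eqxx.
have kC : k \in C by rewrite inE kS eqxx.
pose D := (C :\ e :\ k)%SET.
have CE : (i |: C = e |: (k |: (i |: D)))%SET.
  apply/setP => j; rewrite !(in_setU1, in_setD1).
  have [->|_] := eqVneq j e; first by rewrite eC orbT.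
  by have [->|_] := eqVneq j k; first by rewrite kC orbT.
have DS j : j \in D -> [/\ j \in S, p j = p k & (k < j)%N].
  rewrite !in_setD1 => /andP[jk /andP[je]]; rewrite inE => /andP[jS /eqP pj].
  by split => //; exact: first.
have [D0|[d0 d0D]] := set_0Vmem D.
  rewrite CE D0 finset.setU0.
  have ik : i != k by rewrite neq_ltn lti ?orbT.
  apply: (packable_pocket r_gt0 r_decr ek (leqnn k) _ _ ik); last first.
    exact: second_tail_ring_le_pocket kl (lti l lS).
  by apply: (packable_radius2 r_gt0 pack eC kC); rewrite neq_ltn ek.
pose d := [arg min_(j < d0 in D) (j : nat)]%N.
have [dD d_min] : d \in D /\ forall j, j \in D -> (d <= j)%N.
  by rewrite /d; case: fintype.arg_minnP.
rewrite CE; apply: (@packable_crescent _ _ _ r_gt0 r_decr tail_le _ _ _ d) => //.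
- by move=> j; rewrite in_setU1 => /orP[/eqP->|/DS[]//]; exact: lti.
- by rewrite setU1r.
- move=> j; rewrite in_setU1 => /orP[/eqP->|/d_min//].
  by have [dS _ _] := DS d dD; exact: ltnW (lti d dS).
apply: packableS pack; apply/fintype.subsetP => j; rewrite !in_setU1 finset.in_set1.
move=> /or3P[]/eqP-> //.
by move: dD; rewrite !in_setD1 => /and3P[].
Qed.

(** The rings up to [k] have distinct parents, taken among the pan and the rings
    before [k]: there are as many candidates as rings, so each candidate is the
    parent of one of them, and [c] is not that of [k]. *)
Lemma chain_sibling S p l k c : placement pan r h S p ->
  {in [set j in S | (j < l)%N]%SET &, injective p} -> k \in S -> (k < l)%N ->
  (if c is Some j then (j \in S) && (j < k)%N else true) -> p k != c ->
  exists e, [/\ e \in S, (e < k)%N & p e = c].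
Proof.
move=> P inj kS kl cok pkc; have [av _] := P.
pose A := [set j in S | (j <= k)%N]%SET.
pose T := (None |: (Some @: [set j in S | (j < k)%N]))%SET.
have sub : (p @: A \subset T)%SET.
  apply/fintype.subsetP => y /imsetP[j]; rewrite inE => /andP[jS jk] -> {y}.
  case pj: (p j) => [m|]; last by rewrite setU11.
  rewrite setU1r // imset_f // inE.
  have := av j jS; rewrite pj /= => ->; exact: leq_trans (parent_lt P jS pj) jk.
have card : #|T| = #|(p @: A)%SET|.
  rewrite card_in_imset; last first.
    move=> x y; rewrite !inE => /andP[xS xk] /andP[yS yk]; apply: inj; rewrite inE.
      by rewrite xS (leq_ltn_trans xk).
    by rewrite yS (leq_ltn_trans yk).
  rewrite cardsU1 (card_imset _ (@Some_inj _)).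
  have -> : None \notin (Some @: [set j in S | (j < k)%N])%SET by apply/imsetP => -[].
  have -> : A = (k |: [set j in S | (j < k)%N])%SET.
    apply/setP => j; rewrite !inE leq_eqVlt; have [->|jk] := eqVneq j k; first by rewrite kS eqxx.
    by rewrite -val_eqE in jk; rewrite (negPf jk).
  by rewrite cardsU1 inE ltnn andbF.
have : c \in T by case: c cok {pkc} => [j cok|_]; rewrite ?setU11 // setU1r // imset_f // inE.
have /eqP <- : (p @: A)%SET == T by rewrite eqEcard sub card leqnn.
move=> /imsetP[e]; rewrite inE => /andP[eS ek] ce; exists e; split=> //.
by rewrite ltn_neqAle ek andbT; apply: contraNneq pkc => /val_inj <-; rewrite ce.
Qed.

(** The exchange argument: a feasible set of the scan can also be completed from
    any placement that the greedy execution may have reached. *)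
Lemma admits_of_feasible S p q i : (forall j, j \in S -> (j < i)%N) ->
  placement pan r h S p -> placement pan r h (i |: S)%SET q ->
  exists c, admits pan r h S p c i.
Proof.
move=> lti P Q; have [pav [pfit ppack]] := P; have [qav [qfit qpack]] := Q.
have iU : i \in (i |: S)%SET by rewrite setU11.
have avi := available_parent lti (leqnn i) Q iU.
have [/forall_inP agree|] := boolP [forall j in S, p j == q j].
  by exists (q i); apply: (admits_of_agree Q) => // j /agree/eqP->.
rewrite negb_forall_in => /exists_inP[k0 k0S k0pq].
pose k := [arg min_(j < k0 | (j \in S) && (p j != q j)) (j : nat)]%N.
have [kS kpq k_min] : [/\ k \in S, p k != q k & forall j, j \in S -> (j < k)%N -> p j = q j].
  rewrite /k; case: fintype.arg_minnP => [|k' /andP[k'S k'pq] k'_min]; first by rewrite k0S.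
  split=> // j jS jk; apply/eqP; apply: contraLR jk => jpq; rewrite -leqNgt.
  by apply: k'_min; rewrite jS.
have kU : k \in (i |: S)%SET by rewrite setU1r.
have avk := available_parent lti (ltnW (lti k kS)) Q kU.
pose l := [arg max_(j > k in S) (j : nat)]%N.
have [lS l_max] : l \in S /\ forall j, j \in S -> (j <= l)%N.
  by rewrite /l; case: fintype.arg_maxnP.
have [kl|lk] := ltnP k l; last first.
  have lt_k j : j \in S -> j != k -> (j < k)%N.
    move=> jS jk; rewrite ltn_neqAle -val_eqE in jk *; rewrite jk /=.
    exact: leq_trans (l_max j jS) lk.
  have agree c j : c != p k -> j \in S -> p j = c -> q j = c.
    move=> cpk jS pj; rewrite -pj; apply/esym/k_min => //; apply: lt_k => //.
    by apply: contraNneq cpk => <-; rewrite pj.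
  have [qik|qik] := eqVneq (q i) (p k); last first.
    by exists (q i); apply: (admits_of_agree Q) => // j; exact: agree.
  exists (q k); split=> //.
  have qkp : q k != p k by rewrite eq_sym.
  apply: (@packable_replace _ _ _ k); first by rewrite inE (negPf kpq) andbF.
    exact: ltW (r_decr (lti k kS)).
  apply: packableS (qpack _ (qav k kU)); apply/fintype.subsetP => j.
  rewrite in_setU1 !inE => /orP[/eqP->|/andP[jS /eqP pj]]; first by rewrite kS eqxx orbT.
  by rewrite jS orbT (agree _ j qkp jS pj) eqxx.
(* A first pair of siblings before l: the smaller ring y of the pair comes as
   early as possible, so that no third sibling precedes it. *)
pose two y := (y \in S) && (y < l)%N && [exists x in S, (x < y)%N && (p x == p y)].
have [/existsP[y0 y0two]|/existsPn none] := boolP [exists y, two y].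
  pose y := [arg min_(y < y0 | two y) (y : nat)]%N.
  have [ytwo y_min] : two y /\ forall z, two z -> (y <= z)%N.
    by rewrite /y; case: fintype.arg_minnP.
  move: ytwo => /andP[/andP[yS yl] /exists_inP[x xS /andP[xy /eqP pxy]]].
  exists (p y); apply: (@admits_two_children _ _ _ l x) => // j jS pj jx jy.
  rewrite ltnNge; apply/negP => jley.
  have {}jy : (j < y)%N by rewrite ltn_neqAle jley andbT; exact: jy.
  have [jltx|xlej] := ltnP j x.
    have : two x.
      rewrite /two xS (ltn_trans xy yl) /=; apply/exists_inP; exists j => //.
      by rewrite jltx pj pxy eqxx.
    by move/y_min; rewrite leqNgt xy.
  have : two j.
    rewrite /two jS (ltn_trans jy yl) /=; apply/exists_inP; exists x => //.
    by rewrite pj pxy eqxx andbT ltn_neqAle xlej andbT eq_sym.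
  by move/y_min; rewrite leqNgt jy.
have inj : {in [set j in S | (j < l)%N]%SET &, injective p}.
  move=> x y; rewrite !inE => /andP[xS xl] /andP[yS yl] pxy; apply/eqP.
  case: (ltngtP x y) => [xy|yx|/val_inj->//].
    have := none y; rewrite /two yS yl /= => /exists_inPn/(_ x xS).
    by rewrite xy pxy eqxx.
  have := none x; rewrite /two xS xl /= => /exists_inPn/(_ y yS).
  by rewrite yx pxy eqxx.
have [|e [eS ek pe]] := @chain_sibling S p l k (q k) P inj kS kl _ kpq.
  case qk: (q k) avk => [j|] //= jS; by rewrite jS (parent_lt Q kU qk).
have qe : q e = q k by rewrite -(k_min e eS ek).
exists (q k); split=> //.
have eka : r e + r k <= container_radius pan h (q k).
  apply: (packable_radius2 r_gt0 (qpack _ (qav k kU))); last by rewrite neq_ltn ek.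
    by rewrite !inE eS qe eqxx orbT.
  by rewrite !inE kS eqxx orbT.
have il : i != l by rewrite neq_ltn lti ?orbT.
apply: packableS (packable_pocket r_gt0 r_decr ek (ltnW kl) eka
  (second_tail_ring_le_pocket ek kl (lti l lS)) il).
apply/fintype.subsetP => j; rewrite !inE => /orP[->|/andP[jS /eqP pj]]; first by rewrite !orbT.
have [jl|jl] := ltnP j l; last first.
  suff -> : j = l by rewrite eqxx orbT.
  by apply: val_inj; apply/eqP; rewrite eqn_leq l_max.
suff -> : j = e by rewrite eqxx.
by apply: inj; rewrite ?inE ?jS ?eS ?jl ?(ltn_trans ek kl) // pj pe.
Qed.

Lemma placement_extend S p i c : i \notin S -> placement pan r h S p ->
  admits pan r h S p c i ->
  placement pan r h (i |: S)%SET (fun j => if j == i then c else p j).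
Proof.
move=> iS [av [fit pack]] [avc packc].
have avS c' : available S c' -> available (i |: S)%SET c'.
  by case: c' => //= j jS; rewrite setU1r.
split; [|split].
- move=> j; rewrite in_setU1; have [_ _|_ /= jS] := eqVneq j i; apply: avS => //; exact: av.
- move=> j k; rewrite in_setU1; have [-> _ ck|_ /= jS] := eqVneq j i; last exact: fit.
  have := packable_radius r_gt0 packc (setU11 i _); by rewrite ck.
move=> c' avc'.
have chE j : j \in S -> (j == i) = false by move=> jS; apply: contraNF iS => /eqP <-.
have chP : packable r (container_radius pan h c') (children S p c').
  have [avS'|] := boolP (available S c'); first exact: pack.
  case: c' avc' => //= j; rewrite in_setU1 => /orP[/eqP-> _|-> //].
  rewrite (_ : children _ _ _ = finset.set0); first exact: packable0.
  apply/setP => l; rewrite !inE; apply/negP => /andP[lS /eqP pl].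
  by have := av l lS; rewrite pl /= (negPf iS).
have [->|cc'] := eqVneq c' c.
  apply: packableS packc; apply/fintype.subsetP => j; rewrite !inE.
  by case: (j == i) => //= /andP[-> ->].
apply: packableS chP; apply/fintype.subsetP => j; rewrite !inE.
by case: (j == i) => //=; rewrite eq_sym (negPf cc').
Qed.

(** The three claims are carried together by the induction: a placement is needed
    to apply [admits_of_feasible], and the inclusion in [s] says that the rings
    of [S] precede the next one. *)
Lemma greedy_run_lexmax s S p : pairwise (fun i j : 'I_n => (i < j)%N) s ->
  greedy_run pan r h s S p ->
  [/\ placement pan r h S p, {subset S <= s} &
      S = foldl (fun L i => if `[< feasible pan r h (i |: L)%SET >]
                    then (i |: L)%SET else L) finset.set0 s].
Proof.
move=> + run; elim: run => {s S p} [p|s S p i c run IH adm|s S p i run IH none].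
- split=> //; first split; [|split|].
  + by move=> i; rewrite inE.
  + by move=> i j; rewrite inE.
  + move=> c _; rewrite (_ : children _ _ _ = finset.set0); first exact: packable0.
    by apply/setP => j; rewrite !inE.
  + by move=> i; rewrite inE.
- rewrite pairwise_rcons => /andP[/allP lt /IH[P sub SE]].
  have iS : i \notin S by apply/negP => /sub/lt; rewrite ltnn.
  have P' := placement_extend iS P adm.
  split=> //.
    by move=> j; rewrite in_setU1 mem_rcons in_cons => /orP[->//|/sub->]; rewrite orbT.
  rewrite foldl_rcons -SE ifT //; apply/asboolP; by eexists; exact: P'.
- rewrite pairwise_rcons => /andP[/allP lt /IH[P sub SE]]; split=> //.
    by move=> j /sub; rewrite mem_rcons in_cons => ->; rewrite orbT.
  rewrite foldl_rcons -SE ifF //; apply/asboolP => -[q Q].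
  have [c] := admits_of_feasible (fun j jS => lt j (sub j jS)) P Q.
  exact: none.
Qed.

Lemma greedy_execution_lexmax S p :
  greedy_execution pan r h S p -> S = lexmax_feasible pan r h.
Proof.
have sorted_enum : pairwise (fun i j : 'I_n => (i < j)%N) (enum 'I_n).
  rewrite -(pairwise_map val ltn) val_enum_ord -sorted_pairwise; last exact: ltn_trans.
  exact: iota_ltn_sorted.
by move=> /(greedy_run_lexmax sorted_enum)[].
Qed.

End Greedy.

Lemma rho_tail (R : realType) (n : nat) (r : 'I_n -> R) : (forall i, 0 < r i) ->
  rho r <= phi R -> forall i : 'I_n, \sum_(j : 'I_n | (i < j)%N) r j <= phi R * r i.
Proof.
move=> r_gt0 le i; rewrite -ler_pdivrMr //; apply: le_trans le.
exact: (le_bigmax _ (fun i : 'I_n => (\sum_(j < n | (i < j)%N) r j) / r i)).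
Qed.

Theorem theorem22 (R : realType) (n : nat) (pan : R) (r : 'I_n -> R)
    (pan_gt0 : 0 < pan)
    (r_gt0 : forall i, 0 < r i)
    (r_decr : forall i j : 'I_n, (i < j)%N -> r j < r i)
    (rho_le : rho r <= phi R) :
  (forall w : R, 0 < w ->
     forall (S : {set 'I_n}) (par : 'I_n -> option 'I_n),
       greedy_execution pan r (width_hole r w) S par ->
       S = lexmax_feasible pan r (width_hole r w)) /\
  (forall h : 'I_n -> R, (forall i, 0 <= h i < r i) ->
     forall (S : {set 'I_n}) (par : 'I_n -> option 'I_n),
       greedy_execution pan r h S par ->
       S = lexmax_feasible pan r h).
Proof.
have tails := rho_tail r_gt0 rho_le.
split=> [w w0|h h_lt] S par; apply: greedy_execution_lexmax => // i.
  by rewrite /width_hole gt_max r_gt0 ltrBlDr ltrDl.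
by have /andP[] := h_lt i.
Qed.
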